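(* Let $N\geq3$ be an odd integer and let $\alpha>0$. If $\mathcal{I}_{\alpha,N}(u)\geq0$ for all $u\in\mathcal{L}_{r,N}$, then $\alpha\geq\frac12$.
   Context: $\mathbb{S}^N\subset\mathbb{R}^{N+1}$ is the round unit sphere with points $\xi=(\xi_1,\dots,\xi_{N+1})$. A function on $\mathbb{S}^N$ is axially symmetric if (up to rotation) it is a function $u=u(x)$ of $x=\xi_1\in[-1,1]$. For odd $N$, acting on axially symmetric functions, $$P_{r,N}u=\left(-(1-x^2)\frac{d^2}{dx^2}+Nx\frac{d}{dx}+\Bigl(\frac{N-1}{2}\Bigr)^2\right)^{1/2}\prod_{k=0}^{\frac{N-3}{2}}\left(-(1-x^2)\frac{d^2}{dx^2}+Nx\frac{d}{dx}+k(N-k-1)\right)u,$$ the square root being understood spectrally; equivalently, if $F_k$ is the Gegenbauer polynomial of degree $k$ with parameter $\frac{N-1}{2}$ normalized by $F_k(1)=1$, then $P_{r,N}F_k=\frac{\Gamma(k+N)}{\Gamma(k)}F_k$ for $k\geq1$ and $P_{r,N}F_0=0$. Define $$\begin{aligned}\mathcal{I}_{\alpha,N}(u)={}&\frac{\alpha}{2}\int_{-1}^1(1-x^2)^{\frac{N-2}{2}}u\,P_{r,N}u\,dx+(N-1)!\int_{-1}^1(1-x^2)^{\frac{N-2}{2}}u\,dx\\&-\frac{(N-1)!\sqrt{\pi}\,\Gamma(\frac N2)}{N\,\Gamma(\frac{N+1}{2})}\log\left(\frac{\Gamma(\frac{N+1}{2})}{\sqrt\pi\,\Gamma(\frac N2)}\int_{-1}^1(1-x^2)^{\frac{N-2}{2}}e^{Nu}\,dx\right),\end{aligned}$$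 where the first integral is understood as the associated quadratic form, and $$\mathcal{L}_{r,N}=\Bigl\{u\in H^{N/2}(\mathbb{S}^N):\ u=u(x)\ \text{and}\ \int_{-1}^1x(1-x^2)^{\frac{N-2}{2}}e^{Nu}\,dx=0\Bigr\}.$$ *)

(* Defs.v *)
From HB Require Import structures.
From mathcomp Require Import all_boot all_order all_algebra.
From mathcomp Require Import all_classical all_reals all_analysis.
Set Implicit Arguments.
Unset Strict Implicit.
Unset Printing Implicit Defensive.
Import Order.TTheory GRing.Theory Num.Theory.
Import numFieldNormedType.Exports.
Local Open Scope classical_set_scope.
Local Open Scope ring_scope.

(* An axially symmetric function on the sphere S^N is represented by its
   profile u : R -> R, a function of x = xi_1, of which only the restriction to
   [-1, 1] matters. *)

Section AxiallySymmetric.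
Context {R : realType}.
Implicit Types (N k : nat) (u f : R -> R) (l alpha : R).

(* Euler's integral; only used at s > 0, where it converges. *)
Definition Gamma (s : R) : R :=
  Rintegral lebesgue_measure `]0, +oo[ (fun t => t `^ (s - 1) * expR (- t)).

(* Gegenbauer polynomials C_k^(l), by the three-term recurrence
   k C_k = 2 (k - 1 + l) x C_(k-1) - (k - 2 + 2 l) C_(k-2). *)
Fixpoint gegenbauer l k : {poly R} :=
  match k with
  | 0 => 1
  | k1.+1 =>
      match k1 with
      | 0 => (2 * l) *: 'X
      | k2.+1 => k%:R^-1 *: ((2 * (k1%:R + l)) *: ('X * gegenbauer l k1)
                             - (k2%:R + 2 * l) *: gegenbauer l k2)
      end
  end.

(* The axially symmetric spherical harmonic of degree k, equal to 1 at the
   pole x = 1. *)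
Definition zonal N k : {poly R} :=
  let C := gegenbauer ((N%:R - 1) / 2) k in C.[1]^-1 *: C.

Definition weight N (x : R) : R := (1 - x ^+ 2) `^ ((N%:R - 2) / 2).

(* Up to the area of S^(N-1), the integral over S^N of f(xi_1). *)
Definition wint N f : R :=
  Rintegral lebesgue_measure `[-1, 1] (fun x => weight N x * f x).

Definition zonal_norm2 N k : R := wint N (fun x => (zonal N k).[x] ^+ 2).

(* The degree-k spherical harmonic component of u is
   zonal_coef N u k *: zonal N k. *)
Definition zonal_coef N u k : R :=
  wint N (fun x => u x * (zonal N k).[x]) / zonal_norm2 N k.

(* Eigenvalue on zonal N k of the operator P_(r,N), which for odd N is
   (D + ((N-1)/2)^2)^(1/2) \prod_(0 <= j <= (N-3)/2) (D + j (N-j-1)), where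
   D = - (1-x^2) d^2/dx^2 + N x d/dx has eigenvalue k (k+N-1) on zonal N k: the
   square root gives k + (N-1)/2 and the j-th factor (k+j) (k+N-1-j). *)
Definition P_eigenvalue N k : R :=
  if k == 0%N then 0 else Gamma (k + N)%:R / Gamma k%:R.

(* The quadratic form of P_(r,N), i.e. the integral of
   (1 - x^2)^((N-2)/2) u P_(r,N) u. *)
Definition P_form N u : R :=
  limn (series (fun k =>
    P_eigenvalue N k * zonal_coef N u k ^+ 2 * zonal_norm2 N k)).

(* u is square-integrable on the sphere, up to null sets. *)
Definition axial_L2 N u : Prop :=
  measurable_fun (`[-1, 1] : set R) u /\
  (@lebesgue_measure R).-integrable `[-1, 1]
    (fun x => (weight N x * u x ^+ 2)%:E).

(* The Sobolev space H^s(S^N), restricted to axially symmetric functions: u and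
   (1 - Delta)^(s/2) u are in L^2, where -Delta = k (k + N - 1) on spherical
   harmonics of degree k. *)
Definition axial_sobolev N (s : R) u : Prop :=
  axial_L2 N u /\
  cvgn (series (fun k =>
    (1 + (k * (k + N - 1))%:R) `^ s * zonal_coef N u k ^+ 2 * zonal_norm2 N k)).

Definition L_r N u : Prop :=
  axial_sobolev N (N%:R / 2) u /\
  wint N (fun x => x * expR (N%:R * u x)) = 0.

Definition I_functional alpha N u : R :=
  alpha / 2 * P_form N u
  + (N.-1)`!%:R * wint N u
  - (N.-1)`!%:R * Num.sqrt pi * Gamma (N%:R / 2)
      / (N%:R * Gamma ((N%:R + 1) / 2))
    * ln (Gamma ((N%:R + 1) / 2) / (Num.sqrt pi * Gamma (N%:R / 2))
          * wint N (fun x => expR (N%:R * u x))).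

End AxiallySymmetric.

(* Main.v *)
Require Import Defs.
From mathcomp Require Import all_boot all_order all_algebra.
From mathcomp Require Import all_classical all_reals all_analysis.
From mathcomp Require Import measurable_realfun polyrcf ring lra zify.
Set Implicit Arguments.
Unset Strict Implicit.
Unset Printing Implicit Defensive.
Import Order.TTheory GRing.Theory Num.Theory.
Import numFieldNormedType.Exports.
Local Open Scope classical_set_scope.
Local Open Scope ring_scope.

(** Test the inequality on even polynomials that concentrate at both poles, so
    that the centering constraint holds by symmetry. Write F_k for the zonal
    harmonics, h_k for their squared norms, lambda_k for the eigenvalues of
    P_(r,N) and W for the integral of 1. Then lambda_k h_k = A / a_k with
    A = (N-1)! W and a_k = 1/k + 1/(k+N-1), and the test function is
      u_n = \sum_(1 <= j <= n) 2 a_(2j) F_(2j),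
    a truncated Green function. With L_n = \sum_(1 <= j <= n) a_(2j) one has
      int u_n P u_n = 4 A L_n,   int u_n = 0,   u_n(1) = 2 L_n.
    Since |F_k'| <= F_k'(1) on [0, 1], u_n >= 2 L_n - O(1) for
    1 - x <= n^-2, whence
      log (int e^(N u_n)) >= N (2 L_n - ln n) - O(1).
    Nonnegativity of the functional thus gives
    2 alpha L_n - (2 L_n - ln n) + O(1) >= 0. As L_n >= ln n - O(1), for
    alpha < 1/2 this would bound (1 - 2 alpha) ln n uniformly in n. *)

(** * Gegenbauer polynomials: contiguity relations, differential equation, Sonin bound *)

Section Gegenbauer.
Context {R : realType}.
Implicit Types (l a b x : R) (k : nat) (p q : {poly R}).

Lemma gegenbauer_rec l k :
  k.+2%:R%:P * gegenbauer l k.+2 =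
  (2 * (k.+1%:R + l))%:P * 'X * gegenbauer l k.+1
  - (k%:R + 2 * l)%:P * gegenbauer l k.
Proof.
rewrite [gegenbauer l k.+2]/= !mul_polyC scalerA mulfV ?pnatr_eq0// scale1r.
by rewrite scalerAl.
Qed.

(* The two contiguity relations have to be proved together, since each one at
   [k.+1] uses both at [k]. *)
Lemma gegenbauer_contiguity l k :
  (1 - 'X^2) * (gegenbauer l k.+1)^`() =
    (k%:R + 2 * l)%:P * gegenbauer l k - k.+1%:R%:P * 'X * gegenbauer l k.+1
  /\
  (1 - 'X^2) * (gegenbauer l k)^`() =
    (k%:R + 2 * l)%:P * 'X * gegenbauer l k - k.+1%:R%:P * gegenbauer l k.+1.
Proof.
elim: k => [|k [IHd IHe]].
  split; rewrite /= -?mul_polyC ?derivM ?derivC ?derivX !polyCD !polyCM; ring.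
have rec := gegenbauer_rec l k; have drec := congr1 (@deriv R) rec.
rewrite !(derivB, derivM, derivC, derivX, mul0r, add0r, mulr1) in drec.
set C0 := gegenbauer l k in IHd IHe rec drec *.
set C1 := gegenbauer l k.+1 in IHd IHe rec drec *.
set C2 := gegenbauer l k.+2 in rec drec *.
have k2 : k.+2%:R%:P != 0 :> {poly R} by rewrite polyC_eq0 pnatr_eq0.
have ek k' : k'.+1%:R%:P = k'%:R%:P + 1 :> {poly R} by rewrite -natr1 polyCD.
split.
(* The factor k + 2 brings in the differentiated recurrence; after multiplication by 1 - X^2 the
   induction hypotheses replace every derivative. *)
- apply: (mulfI k2).
  transitivity ((2 * (k.+1%:R + l))%:P * ((1 - 'X^2) * C1 + 'X * ((1 - 'X^2) * C1^`()))
     - (k%:R + 2 * l)%:P * ((1 - 'X^2) * C0^`())).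
    by rewrite mulrCA drec; ring.
  transitivity (k.+2%:R%:P * (k.+1%:R + 2 * l)%:P * C1
      - k.+2%:R%:P * 'X * (k.+2%:R%:P * C2)); last by ring.
  rewrite rec IHd IHe !polyCD !polyCM !ek !polyCD; ring.
- rewrite rec IHd !polyCD !polyCM !ek; ring.
Qed.

Lemma oneBX2_neq0 : 1 - 'X^2 != 0 :> {poly R}.
Proof.
apply/eqP => /(congr1 (horner^~ 0)); rewrite !hornerE /= => /eqP.
by rewrite expr0n/= subr0 oner_eq0.
Qed.

(** Differentiate the second contiguity relation. The derivative of [C1] goes by the first relation
    once everything is multiplied by 1 - X^2, then [C1] itself goes by the second; the extra factor
    1 - X^2 cancels. *)
Lemma gegenbauer_ode l k (C := gegenbauer l k) :
  (1 - 'X^2) * C^`()^`() - (2 * l + 1)%:P * 'X * C^`()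
  + (k%:R * (k%:R + 2 * l))%:P * C = 0.
Proof.
have [d e] := gegenbauer_contiguity l k; rewrite -/C in d e.
have de := congr1 (@deriv R) e.
rewrite !(derivB, derivM, derivC, derivXn, derivX, mul0r, add0r, mulr1) /= in de.
set C1 := gegenbauer l k.+1 in d e de.
have {}e : k.+1%:R%:P * C1 = (k%:R + 2 * l)%:P * 'X * C - (1 - 'X^2) * C^`().
  by rewrite e; ring.
apply: (mulfI oneBX2_neq0); rewrite mulr0.
transitivity ((1 - 'X^2) * ('X^1 *- 2 * C^`() + (1 - 'X^2) * C^`()^`())
   + (1 - 'X^2) * ('X *+ 2 * C^`() - (2 * l + 1)%:P * 'X * C^`()
   + (k%:R * (k%:R + 2 * l))%:P * C)); first by ring.
rewrite de.
transitivity ((1 - 'X^2) * ((k%:R + 2 * l)%:P * (C + 'X * C^`()))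
  - k.+1%:R%:P * ((1 - 'X^2) * C1^`())
   + (1 - 'X^2) * ('X *+ 2 * C^`() - (2 * l + 1)%:P * 'X * C^`()
   + (k%:R * (k%:R + 2 * l))%:P * C)); first by ring.
rewrite d.
transitivity ((1 - 'X^2) * ((k%:R + 2 * l)%:P * (C + 'X * C^`()))
  - k.+1%:R%:P * (k%:R + 2 * l)%:P * C + k.+1%:R%:P * 'X * (k.+1%:R%:P * C1)
   + (1 - 'X^2) * ('X *+ 2 * C^`() - (2 * l + 1)%:P * 'X * C^`()
   + (k%:R * (k%:R + 2 * l))%:P * C)); first by ring.
rewrite e -natr1 !polyCD !polyCM; ring.
Qed.

Lemma gegenbauer1_rec l k :
  k.+1%:R * (gegenbauer l k.+1).[1] = (k%:R + 2 * l) * (gegenbauer l k).[1].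
Proof.
have [_ /(congr1 (horner^~ 1))] := gegenbauer_contiguity l k.
rewrite !hornerE /= expr1n subrr mul0r => /esym/eqP; rewrite subr_eq0.
by move=> /eqP <-.
Qed.

Lemma gegenbauer1_gt0 l k : 0 < l -> 0 < (gegenbauer l k).[1].
Proof.
move=> l0; elim: k => [|k IH]; first by rewrite /= hornerE.
have := gegenbauer1_rec l k => /(congr1 (fun y => k.+1%:R^-1 * y)).
rewrite mulKf ?pnatr_eq0// => ->.
by rewrite mulr_gt0 ?invr_gt0 ?ltr0n// mulr_gt0// ltr_wpDl// mulr_gt0.
Qed.

Lemma gegenbauerN l k x :
  (gegenbauer l k).[- x] = (-1) ^+ k * (gegenbauer l k).[x].
Proof.
suff [] : (gegenbauer l k).[- x] = (-1) ^+ k * (gegenbauer l k).[x]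
  /\ (gegenbauer l k.+1).[- x] = (-1) ^+ k.+1 * (gegenbauer l k.+1).[x] by [].
elim: k => [|k [IH0 IH1]].
  split; first by rewrite expr0 mul1r /= !hornerE.
  by rewrite expr1 mulN1r /= !hornerE mulrN.
split=> //; have k2 : k.+2%:R != 0 :> R by rewrite pnatr_eq0.
have h y : k.+2%:R * (gegenbauer l k.+2).[y] =
  2 * (k.+1%:R + l) * y * (gegenbauer l k.+1).[y]
  - (k%:R + 2 * l) * (gegenbauer l k).[y].
  by have /(congr1 (horner^~ y)) := gegenbauer_rec l k; rewrite !hornerE.
by apply: (mulfI k2); rewrite h IH0 IH1 [RHS]mulrCA h !exprS; ring.
Qed.

(* Sonin's argument: [p^2 + (1 - x^2) p'^2 / b] increases on [0, 1]. *)
Lemma sonin_bound p a b x : 1 <= a -> 0 < b ->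
  (1 - 'X^2) * p^`()^`() - a%:P * 'X * p^`() + b%:P * p = 0 ->
  0 <= x <= 1 -> `|p.[x]| <= `|p.[1]|.
Proof.
move=> a1 b0 ode /andP[x0 x1].
pose E := p ^+ 2 + (b^-1)%:P * (1 - 'X^2) * p^`() ^+ 2.
(* The equation eliminates p'' and cancels the p p' terms; what remains is nonnegative on [0, 1]
   because a >= 1. *)
have dE : E^`() = (2 * b^-1 * (a - 1))%:P * 'X * p^`() ^+ 2.
  rewrite /E !expr2 !(derivD, derivN, derivM, derivC, derivX).
  have bb : (b^-1)%:P * b%:P = 1 :> {poly R} by rewrite -polyCM mulVf// gt_eqF.
  transitivity ((2 * b^-1)%:P * p^`() * ((1 - 'X^2) * p^`()^`() + b%:P * p)
     - (2 * b^-1)%:P * 'X * p^`() * p^`()).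
    have bbp : (2 * b^-1)%:P * p^`() * (b%:P * p) = p^`() * p *+ 2.
      transitivity (2 * ((b^-1)%:P * b%:P) * p^`() * p).
        by rewrite polyCM polyC_natr; ring.
      by rewrite bb; ring.
    by rewrite (mulrDr (_%:P * p^`())) bbp polyCM polyC_natr; ring.
  have -> : (1 - 'X^2) * p^`()^`() + b%:P * p = a%:P * 'X * p^`().
    by apply/eqP; rewrite -subr_eq0 -[X in _ == X]ode; apply/eqP; ring.
  by rewrite !polyCM polyCB polyC_natr; ring.
have Ex : E.[x] <= E.[1].
  move: x1; rewrite le_eqVlt => /predU1P[->//|x1].
  have [c /[!in_itv]/= /andP[xc c1] EE] := poly_mvt E x1.
  rewrite -subr_ge0 EE mulr_ge0 ?subr_ge0 ?(ltW x1)// dE.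
  rewrite !(hornerM, hornerC, hornerX, horner_exp) mulr_ge0 ?sqr_ge0//.
  rewrite mulr_ge0 ?(le_trans x0 (ltW xc))//.
  by rewrite !mulr_ge0 ?subr_ge0// ltW// invr_gt0.
rewrite -ler_sqr ?nnegrE// -!normrX !ger0_norm ?sqr_ge0//.
move: Ex; rewrite /E !(hornerD, hornerN, hornerM, hornerC, hornerX, horner_exp).
rewrite mulr1 subrr mulr0 mul0r addr0 -!expr2; apply: le_trans.
rewrite lerDl mulr_ge0 ?sqr_ge0// mulr_ge0 ?invr_ge0 ?(ltW b0)//.
by rewrite subr_ge0 expr_le1.
Qed.

End Gegenbauer.

(** * Integrals of continuous functions over segments *)

Section FTC.
Context {R : realType}.
Notation mu := (@lebesgue_measure R).
Implicit Types (f F : R -> R) (a b x : R).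

Lemma continuous_integrable_itv f a b : continuous f ->
  mu.-integrable `[a, b] (EFin \o f).
Proof.
move=> cf; apply: continuous_compact_integrable; first exact: segment_compact.
exact: continuous_subspaceT.
Qed.

Lemma Rintegral_FTC2 f F a b : a < b -> continuous f -> continuous F ->
  (forall x, a < x < b -> is_derive x 1 F (f x)) ->
  \int[mu]_(x in `[a, b]) f x = F b - F a.
Proof.
move=> ab cf cF dF; rewrite /Rintegral (continuous_FTC2 (F := F)) //.
- exact: continuous_subspaceT.
- split.
  + by move=> x /[!in_itv]/= /dF [].
  + apply: cvg_at_right_filter; exact: cF.
  + apply: cvg_at_left_filter; exact: cF.
- by move=> x /[!in_itv]/= /dF h; rewrite derive1E; exact: derive_val.
Qed.

End FTC.

(** * Weighted integrals on [-1, 1] for odd N = 2m + 3 *)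

Section Weight.
Context {R : realType}.
Notation mu := (@lebesgue_measure R).
Variable m : nat.
Let N := m.*2.+3.
Implicit Types (f g : R -> R) (p q : {poly R}) (a x : R).

(** Since (N-2)/2 = m + 1/2, this agrees with the weight on [-1, 1]. It is continuous on the whole
    line, because [Num.sqrt] vanishes on negative numbers, so results about globally continuous
    integrands apply. *)
Let w x : R := ((1 - 'X^2) ^+ m).[x] * Num.sqrt (1 - 'X^2).[x].

Let cont_w : continuous w.
Proof.
move=> x; apply: continuousM; first exact: continuous_horner.
by apply: continuous_comp; [exact: continuous_horner|exact: sqrt_continuous].
Qed.

Let hornerQ x : (1 - 'X^2 : {poly R}).[x] = 1 - x ^+ 2.
Proof. by rewrite hornerD hornerN hornerXn hornerC. Qed.

Lemma weightE x : x \in `[-1, 1]%R ->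
  weight N x = (1 - x ^+ 2) ^+ m * Num.sqrt (1 - x ^+ 2).
Proof.
rewrite in_itv/= => /andP[x1 x2].
have h : 0 <= 1 - x ^+ 2.
  by rewrite subr_ge0 -real_normK ?num_real// expr_le1// ler_norml x1.
rewrite /weight (_ : (N%:R - 2) / 2 = m%:R + 2^-1 :> R).
  rewrite powRD; last by rewrite gt_eqF// ltr_wpDl// invr_gt0.
  by rewrite powR_mulrn// powR12_sqrt.
by rewrite /N -addn3 natrD -muln2 natrM; field.
Qed.

Let weightw x : x \in `[-1, 1]%R -> weight N x = w x.
Proof. by move=> /weightE ->; rewrite /w horner_exp hornerQ. Qed.

Lemma weight_ge0 x : 0 <= weight N x :> R.
Proof. exact: powR_ge0. Qed.

Let wintE f : wint N f = \int[mu]_(x in `[-1, 1]) (w x * f x).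
Proof.
by rewrite /wint; apply: eq_Rintegral => x /[!inE] xI; rewrite weightw.
Qed.

Lemma wint_integrable f : continuous f ->
  mu.-integrable `[-1, 1] (EFin \o (fun x => weight N x * f x)).
Proof.
move=> cf.
apply: (@eq_integrable _ _ _ mu `[-1, 1]%classic _
  (EFin \o (fun x => w x * f x))) => //.
  by move=> x /[!inE] xI; rewrite /= weightw.
apply: continuous_integrable_itv => x.
by apply: continuousM; [exact: cont_w|exact: cf].
Qed.

Lemma eq_wint f g : {in `[-1, 1]%R, f =1 g} -> wint N f = wint N g.
Proof.
by move=> fg; apply: eq_Rintegral => x /[!inE] /fg ->.
Qed.

Lemma wintD f g : continuous f -> continuous g ->
  wint N (fun x => f x + g x) = wint N f + wint N g.
Proof.
move=> cf cg; rewrite /wint -RintegralD//; try exact: wint_integrable.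
by apply: eq_Rintegral => x _; rewrite mulrDr.
Qed.

Lemma wintZ a f : continuous f -> wint N (fun x => a * f x) = a * wint N f.
Proof.
move=> cf; rewrite /wint -RintegralZl//; last exact: wint_integrable.
by apply: eq_Rintegral => x _; rewrite mulrCA.
Qed.

(** The reflection x -> -x preserves the weight and negates f, so the integral equals its own
    opposite. *)
Lemma wint_odd f : continuous f -> (forall x, f (- x) = - f x) -> wint N f = 0.
Proof.
move=> cf fN; pose h x := w x * f x.
have ch : continuous h by move=> x; apply: continuousM; [exact: cont_w|exact: cf].
have hN x : h (- x) = - h x.
  by rewrite /h fN /w !horner_exp !hornerQ sqrrN mulrN.
have : wint N f = - wint N f.
  rewrite wintE {1}/Rintegral.
  have := @integration_by_substitution_oppr R h (-1) 1.
  rewrite opprK => ->; [|lra|exact: continuous_subspaceT].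
  rewrite -[RHS]mulN1r -RintegralZl//; last exact: continuous_integrable_itv.
  by rewrite /Rintegral; congr fine; apply: eq_integral => x _ /=; rewrite hN mulN1r.
by move=> ?; lra.
Qed.

(* The primitive is [(1 - x^2)^(N/2) q]. *)
Lemma wint_divergence q :
  wint N (horner ((1 - 'X^2) * q^`() - N%:R%:P * 'X * q)) = 0.
Proof.
pose P : {poly R} := (1 - 'X^2) ^+ m.+1 * q.
pose F x := Num.sqrt (1 - 'X^2).[x] * P.[x].
rewrite wintE; transitivity (F 1 - F (-1)).
apply: Rintegral_FTC2.
- lra.
- by move=> x; apply: continuousM; [exact: cont_w|exact: continuous_horner].
- have cs : continuous (fun x => Num.sqrt (1 - 'X^2 : {poly R}).[x]).
    by move=> x; apply: continuous_comp; [exact: continuous_horner|exact: sqrt_continuous].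
  by move=> x; exact: (continuousM (cs x) (@continuous_horner _ P x)).
- move=> x /andP[x1 x2].
  have h : 0 < (1 - 'X^2 : {poly R}).[x].
    by rewrite hornerQ subr_gt0 -real_normK ?num_real// expr_lt1// ltr_norml x1.
  pose s := Num.sqrt (1 - 'X^2 : {poly R}).[x].
  have s0 : s != 0 by rewrite gt_eqF// sqrtr_gt0.
  have s2 : s * s = (1 - 'X^2 : {poly R}).[x] by rewrite -expr2 sqr_sqrtr// ltW.
  have dh := @is_derive_poly R (1 - 'X^2) x.
  have ds := is_derive1_comp (is_derive1_sqrt h) dh.
  apply: (is_derive_eq (is_deriveM ds (@is_derive_poly R P x))).
  rewrite /GRing.scale/= -/s /P exprS /w -/s !(derivM, derivX) deriv_exp/=.
  rewrite derivB derivC derivXn/= sub0r expr1.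
  rewrite !(hornerD, hornerN, hornerM, hornerMn, horner_exp, hornerX, hornerXn, hornerC).
  (* The truncated exponent [m.-1] is harmless at m = 0, where the factor m kills the term. *)
  have -> : (1 - x * x) * (- (x + x) * (1 - x * x) ^+ m.-1 *+ m)
      = - (x + x) * m%:R * (1 - x * x) ^+ m.
    by case: (m) => [|k]; rewrite ?mulr0n ?mulr0 ?mul0r// -mulr_natr exprS /=; ring.
  rewrite (_ : N%:R = m%:R * 2 + 3); last by rewrite /N -addn3 natrD -muln2 natrM.
  rewrite hornerQ expr2 in s2.
  rewrite -s2.
  by field.
- rewrite /F !hornerQ sqrrN expr1n subrr sqrtr0 !mul0r; lra.
Qed.

End Weight.

(** * Orthogonality and norms of the Gegenbauer polynomials *)

Section ZonalNorm.
Context {R : realType}.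
Variable m : nat.
Let N := m.*2.+3.
Let l : R := (N%:R - 1) / 2.
Implicit Types (p q : {poly R}) (a : R).

Let lam p := wint N (horner p).
Let C k : {poly R} := gegenbauer l k.

Let two_l : 2 * l = N%:R - 1. Proof. by rewrite /l; field. Qed.

Let l_gt0 : 0 < l.
Proof. by rewrite divr_gt0// subr_gt0 ltr1n. Qed.

Let lamD p q : lam (p + q) = lam p + lam q.
Proof.
rewrite /lam -wintD; try exact: continuous_horner.
by apply: eq_wint => x _; rewrite hornerD.
Qed.

Let lamZ a p : lam (a%:P * p) = a * lam p.
Proof.
rewrite /lam -wintZ; last exact: continuous_horner.
by apply: eq_wint => x _; rewrite hornerM hornerC.
Qed.

Let lamB p q : lam (p - q) = lam p - lam q.
Proof. by rewrite -mulN1r -polyCN lamD lamZ mulN1r. Qed.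

(** Sturm-Liouville argument: the divergence identity for the Wronskian C_j C_k' - C_k C_j' leaves
    the difference of the eigenvalues times the integral of C_j C_k, and the eigenvalues i (i + 2l)
    are distinct. *)
Lemma gegenbauer_orthogonal j k : j != k ->
  wint N (horner (gegenbauer l j * gegenbauer l k)) = 0.
Proof.
move=> jk; rewrite -/(lam _) -/(C j) -/(C k).
have ode i : (1 - 'X^2) * (C i)^`()^`() - N%:R%:P * 'X * (C i)^`() =
  - (i%:R * (i%:R + 2 * l))%:P * C i.
  have := gegenbauer_ode l i; rewrite -/(C i).
  by rewrite two_l subrK mulNr => /eqP; rewrite addr_eq0 => /eqP.
have := wint_divergence m (C j * (C k)^`() - C k * (C j)^`()).
rewrite -/N -/(lam _) => L.
have : lam ((j%:R * (j%:R + 2 * l) - k%:R * (k%:R + 2 * l))%:P * (C j * C k)) = 0.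
  rewrite -[RHS]L; congr lam.
  transitivity (C j * (- (k%:R * (k%:R + 2 * l))%:P * C k)
              - C k * (- (j%:R * (j%:R + 2 * l))%:P * C j)).
    by rewrite polyCB; ring.
  by rewrite -!ode !(derivB, derivM); ring.
rewrite lamZ => /eqP; rewrite mulf_eq0 => /orP[|/eqP//].
have -> : j%:R * (j%:R + 2 * l) - k%:R * (k%:R + 2 * l) =
  (j%:R - k%:R) * (j%:R + k%:R + 2 * l) by ring.
rewrite mulf_eq0 subr_eq0 eqr_nat (negbTE jk)/= gt_eqF//.
by rewrite ltr_wpDl ?addr_ge0// mulr_gt0.
Qed.

(** The integral of x C_k C_(k+1) is computed twice: from the recurrence for C_(k+1) tested against
    C_(k+1), and from the one for C_(k+2) tested against C_k. Orthogonality removes the third term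
    each time. *)
Lemma gegenbauer_norm_rec k :
  k.+1%:R * (k.+1%:R + l) * wint N (horner (gegenbauer l k.+1 ^+ 2)) =
  (k%:R + l) * (k%:R + 2 * l) * wint N (horner (gegenbauer l k ^+ 2)).
Proof.
rewrite -!/(lam _) -!/(C _).
have up : k.+1%:R * lam (C k.+1 ^+ 2) = 2 * (k%:R + l) * lam ('X * C k * C k.+1).
  case: k => [|k].
    by rewrite -lamZ mul1r add0r -lamZ; congr lam; rewrite /C /= -mul_polyC; ring.
  have h : lam (C k * C k.+2) = 0 by apply: gegenbauer_orthogonal; rewrite ltn_eqF.
  rewrite -[RHS]subr0 -(mulr0 (k%:R + 2 * l)) -[in RHS]h -!lamZ -lamB; congr lam.
  transitivity (C k.+2 * (k.+2%:R%:P * C k.+2)); first by ring.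
  by rewrite gegenbauer_rec -!/(C _); ring.
have down : 2 * (k.+1%:R + l) * lam ('X * C k * C k.+1) =
    (k%:R + 2 * l) * lam (C k ^+ 2).
  have h : lam (C k * C k.+2) = 0 by apply: gegenbauer_orthogonal; rewrite ltn_eqF.
  apply/eqP; rewrite -subr_eq0 -(mulr0 k.+2%:R) -[in X in _ == X]h -!lamZ -lamB.
  apply/eqP; congr lam.
  transitivity (C k * (k.+2%:R%:P * C k.+2)); last by ring.
  by rewrite gegenbauer_rec -!/(C _); ring.
rewrite mulrAC up.
transitivity ((k%:R + l) * (2 * (k.+1%:R + l) * lam ('X * C k * C k.+1))); first by ring.
by rewrite down; ring.
Qed.

Let zonal_norm2E k : zonal_norm2 N k =
  (C k).[1] ^- 2 * wint N (horner (C k ^+ 2)) :> R.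
Proof.
rewrite -wintZ; last exact: continuous_horner.
by apply: eq_wint => x _; rewrite /zonal hornerZ exprMn exprVn horner_exp.
Qed.

(** Induction on k: the recursion for the norms and the one for the values at 1 combine into a
    first-order recursion for the zonal norms, solved by factorials. *)
Lemma zonal_norm2_closed k :
  (zonal_norm2 N k : R) * (k + N - 2)`!%:R * (k.*2 + N - 1)%:R =
  k`!%:R * (N.-1)`!%:R * wint N (fun=> 1).
Proof.
have eN i : (i + N - 2 = i + m.*2.+1)%N by rewrite /N; lia.
have el i : (i.*2 + N - 1)%:R = 2 * (i%:R + l) :> R.
  rewrite mulrDr two_l addrA -addnBA// natrD natrB// -muln2 natrM; ring.
elim: k => [|k IH].
  rewrite zonal_norm2E /C /= hornerC expr1n invr1 mul1r.
  have -> : wint N (horner (1 ^+ 2)) = wint N (fun=> 1) :> R.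
    by apply: eq_wint => x _; rewrite expr1n hornerC.
  rewrite mul1r eN add0n (_ : (0.*2 + N - 1)%N = m.*2.+2); last by rewrite /N; lia.
  by rewrite /= [in RHS]factS natrM; ring.
have {}IH := congr1 ( *%R k.+1%:R) IH.
rewrite el eN in IH; rewrite el eN (_ : k.+1 + m.*2.+1 = (k + m.*2.+1).+1)%N; last by lia.
rewrite (factS k) (factS (k + m.*2.+1)) 2!natrM -!mulrA.
rewrite -!mulrA in IH; rewrite -IH.
have -> : (k + m.*2.+1).+1%:R = k%:R + 2 * l :> R.
  rewrite two_l -addnS natrD /N -[m.*2.+3]addn1 natrD; ring.
have C0 i : (C i).[1] != 0 by rewrite gt_eqF// gegenbauer1_gt0.
have step : (k.+1%:R + l) * (k%:R + 2 * l) * zonal_norm2 N k.+1 =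
    (k%:R + l) * k.+1%:R * zonal_norm2 N k.
  have r1 := gegenbauer1_rec l k; rewrite -!/(C _) in r1.
  have r2 := gegenbauer_norm_rec k; rewrite -!/(C _) in r2.
  have k1 : k.+1%:R != 0 :> R by rewrite pnatr_eq0.
  have kl : k.+1%:R + l != 0 by rewrite gt_eqF// ltr_wpDl.
  have k2l : k%:R + 2 * l != 0 by rewrite gt_eqF// ltr_wpDl// mulr_gt0.
  rewrite !zonal_norm2E.
  have -> : (C k.+1).[1] = (k%:R + 2 * l) * (C k).[1] / k.+1%:R.
    by rewrite -r1 mulrAC mulfV// mul1r.
  have -> : wint N (horner (C k.+1 ^+ 2)) = (k%:R + l) * (k%:R + 2 * l) *
      wint N (horner (C k ^+ 2)) / (k.+1%:R * (k.+1%:R + l)).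
    by rewrite -r2 mulrAC mulfV ?mul1r// mulf_neq0.
  have := C0 k; move: (C k).[1] k1 kl k2l (wint _ _) => c + + + n c0.
  by move: (k.+1%:R : R) => k' k1 kl k2l; field; rewrite c0 k1 kl k2l.
transitivity (2 * (k + m.*2.+1)`!%:R *
   ((k.+1%:R + l) * (k%:R + 2 * l) * zonal_norm2 N k.+1)); first by ring.
by rewrite step; ring.
Qed.

(** Raising N by 2 multiplies the weight by 1 - x^2, and the divergence identity for q = X says that
    1 and (N+1) x^2 have the same integral. *)
Lemma wint1_rec : N.+1%:R * wint N.+2 (fun=> 1) = N%:R * wint N (fun=> 1) :> R.
Proof.
have W1 : lam 1 = wint N (fun=> 1) by apply: eq_wint => x _; rewrite hornerC.
have -> : N.+1%:R = N%:R + 1 :> R by rewrite -natr1.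
have := wint_divergence m ('X : {poly R}); rewrite -/N derivX mulr1.
move: (N%:R : R) => n.
rewrite (_ : _ - _ = 1 - (n + 1)%:P * 'X^2); last by rewrite polyCD; ring.
rewrite -/(lam _) lamB lamZ => WX.
transitivity ((n + 1) * lam (1 - 'X^2)); last by rewrite lamB mulrBr -W1; lra.
congr (_ * _); rewrite /wint/lam; apply: eq_Rintegral => x /[!inE] xI.
rewrite mulr1 (weightE m.+1 xI) (weightE m xI) hornerD hornerN hornerXn hornerC.
by rewrite exprSr; ring.
Qed.

End ZonalNorm.

(** * The total mass of the weight for N = 3 *)

Section WintBase.
Context {R : realType}.
Notation mu := (@lebesgue_measure R).

(** The substitution x = sin t turns the integrand into cos^2 t, with primitive (t + sin t cos t) /
    2. *)
Lemma Rintegral_sqrt_disk :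
  \int[mu]_(x in `[-1, 1]) Num.sqrt (1 - x ^+ 2) = pi / 2.
Proof.
have cs : continuous (fun x : R => Num.sqrt (1 - x ^+ 2)).
  move=> x; apply: (@continuous_comp _ _ _ (fun x : R => 1 - x ^+ 2) Num.sqrt).
    2: exact: sqrt_continuous.
  by apply: continuousB; [exact: cst_continuous|exact: exprn_continuous].
have pi0 := pi_gt0 R.
have dsin : (sin : R -> R)^`()%classic = cos.
  by apply/funext => x; rewrite derive1E; exact: derive_val.
have := @integration_by_substitution_increasing R sin _ (- (pi / 2)) (pi / 2)
  _ _ _ _ _ _ (continuous_subspaceT cs).
rewrite sinN sin_pihalf dsin /Rintegral => ->; first last.
- split.
  + by move=> x _; exact: derivable_sin.
  + by apply: cvg_at_right_filter; exact: continuous_sin.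
  + by apply: cvg_at_left_filter; exact: continuous_sin.
- apply: cvgP; apply: cvg_at_left_filter; exact: continuous_cos.
- apply: cvgP; apply: cvg_at_right_filter; exact: continuous_cos.
- by move=> x _; exact: continuous_cos.
- by move=> x y xI yI; rewrite ltr_sin.
- lra.
transitivity (\int[mu]_(x in `[-(pi/2), pi/2]) cos x ^+ 2).
  apply: eq_Rintegral => x /[!inE]/= /[!in_itv]/= /cos_ge0_pihalf c0.
  by rewrite fctE /= -cos2sin2 sqrtr_sqr ger0_norm// expr2.
pose F (x : R) := (x + sin x * cos x) / 2.
have dF (x : R) : is_derive x 1 F (cos x ^+ 2).
  rewrite /F; apply: is_derive_eq; rewrite /GRing.scale/=.
  have := cos2Dsin2 x; lra.
transitivity (F (pi / 2) - F (- (pi / 2))).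
  apply: Rintegral_FTC2.
  - lra.
  - by move=> x; exact: (continuousM (@continuous_cos _ x) (@continuous_cos _ x)).
  - by move=> x; apply/differentiable_continuous/derivable1_diffP; have [] := dF x.
rewrite /F cosN cos_pihalf !mulr0; lra.
Qed.
End WintBase.

(** * Euler's integral at positive integers and at half-integers from 3/2 on *)

Section GammaValues.
Context {R : realType}.
Notation mu := (@lebesgue_measure R).
Implicit Types (n k : nat) (c g t x : R) (phi : R -> R) (u : R^nat).

(** The exponential series gives e^u >= u^(n+1) / (n+1)!, hence u^n e^(-u) <= (n+1)! / u for u >
    0. *)
Lemma cvg_exprn_expRN u n : u k @[k --> \oo] --> +oo ->
  u k ^+ n * expR (- u k) @[k --> \oo] --> (0 : R).
Proof.
move=> uy; apply: (@squeeze_cvgr _ _ _ _ (cst 0) (fun k => n.+1`!%:R * (u k)^-1)).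
- have /cvgryPge/(_ 1) := uy; apply: filterS => k u1.
  have u0 : 0 < u k by rewrite (lt_le_trans _ u1).
  rewrite /cst mulr_ge0 ?exprn_ge0 ?expR_ge0//; last exact: ltW.
  rewrite expRN ler_pdivrMr ?expR_gt0// mulrAC ler_pdivlMr// -exprSr.
  have := expR_ge1Dxn n (ltW u0).
  rewrite -(ler_pM2l (_ : 0 < n.+1`!%:R)) ?ltr0n ?fact_gt0//.
  rewrite mulrDr mulrCA mulfV ?mulr1 ?pnatr_eq0 -?lt0n ?fact_gt0//.
  by apply: le_trans; rewrite lerDr.
- exact: cvg_cst.
- rewrite -(mulr0 n.+1`!%:R); apply: cvgMr.
  apply/gtr0_cvgV0 => //.
  have /cvgryPge/(_ 1) := uy; apply: filterS => k u1.
  by rewrite (lt_le_trans _ u1).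
Qed.

(** Truncated Euler integral with t^(s-1) split as t^n phi(t): phi = 1 serves integer s and phi =
    [Num.sqrt] half-integer s. Both are continuous on the whole line, so one integration by parts
    covers the two cases. *)
Definition gamma_partial n phi x : R :=
  \int[mu]_(t in `[0, x]) (t ^+ n * phi t * expR (- t)).

Let cont_integrand n phi : continuous phi ->
  continuous (fun t => t ^+ n * phi t * expR (- t)).
Proof.
move=> cphi t.
have ce : {for t, continuous (fun t : R => expR (- t))}.
  apply: (@continuous_comp _ _ _ -%R expR); last exact: continuous_expR.
  exact: oppr_continuous.
exact: (continuousM (continuousM (@exprn_continuous _ n t) (cphi t)) ce).
Qed.

(* Integration by parts; [c = 0] for [phi = 1] and [c = 1/2] for the square
   root. *)
Lemma gamma_partial_step n phi c x : continuous phi ->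
  (forall t, 0 < t -> is_derive t 1 phi (c * phi t / t)) -> 0 < x ->
  gamma_partial n.+1 phi x =
  (n.+1%:R + c) * gamma_partial n phi x - x ^+ n.+1 * phi x * expR (- x).
Proof.
move=> cphi dphi x0.
pose F t := t ^+ n.+1 * phi t * expR (- t).
pose f t := (n.+1%:R + c) * (t ^+ n * phi t * expR (- t)) + (-1) * F t.
have cF : continuous F by exact: cont_integrand.
have cf : continuous f.
  move=> t; apply: (@continuousD _ _ _
    (fun t => (n.+1%:R + c) * (t ^+ n * phi t * expR (- t)))
    (fun t => -1 * F t)).
    exact: (continuousM (@cst_continuous _ _ _ _) (@cont_integrand n phi cphi t)).
  exact: (continuousM (@cst_continuous _ _ _ _) (cF t)).
have dF t : 0 < t < x -> is_derive t 1 F (f t).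
  move=> /andP[t0 _].
  have de : is_derive t 1 (fun t : R => expR (- t)) (- expR (- t)).
    have := is_derive1_comp (is_derive_expR (- t)) (is_deriveNid t (1 : R)).
    by rewrite mulrN1.
  have dp := dphi t t0.
  have -> : F = (id ^+ n.+1) * phi * (fun t : R => expR (- t)).
    by apply/funext => y; rewrite /F !fctE.
  apply: is_derive_eq.
  rewrite /GRing.scale/= /f /F !fctE exprS.
  have {t0} : t != 0 by rewrite gt_eqF.
  by move=> t0; field.
have := Rintegral_FTC2 x0 cf cF dF.
rewrite RintegralD//; last 2 first.
- apply: continuous_integrable_itv => t.
  exact: (continuousM (@cst_continuous _ _ _ _) (@cont_integrand n phi cphi t)).
- apply: continuous_integrable_itv => t.
  exact: (continuousM (@cst_continuous _ _ _ _) (cF t)).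
rewrite !RintegralZl//; try by apply: continuous_integrable_itv; exact: cont_integrand.
rewrite -/(gamma_partial n phi x) -/(gamma_partial n.+1 phi x) mulN1r.
have -> : F 0 = 0 by rewrite /F expr0n !mul0r.
rewrite subr0 -/(F x) => <-.
by rewrite subKr.
Qed.

(** The boundary term of the integration by parts tends to 0; the bound phi(t) <= 1 + t, valid for 1
    and for the square root, reduces this to powers times e^(-t). *)
Lemma cvg_gamma_partial_step u n phi c g : u k @[k --> \oo] --> +oo ->
  continuous phi -> (forall t, 0 <= t -> 0 <= phi t <= 1 + t) ->
  (forall t, 0 < t -> is_derive t 1 phi (c * phi t / t)) ->
  gamma_partial n phi (u k) @[k --> \oo] --> g ->
  gamma_partial n.+1 phi (u k) @[k --> \oo] --> (n.+1%:R + c) * g.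
Proof.
move=> uy cphi phi_le dphi Jg.
have upos : \forall k \near \oo, 0 < u k.
  have /cvgryPge/(_ 1) := uy; apply: filterS => k u1.
  by rewrite (lt_le_trans _ u1).
have lim0 : u k ^+ n.+1 * phi (u k) * expR (- u k) @[k --> \oo] --> (0 : R).
  apply: (@squeeze_cvgr _ _ _ _ (cst 0)
    (fun k => u k ^+ n.+1 * expR (- u k) + u k ^+ n.+2 * expR (- u k))).
  - apply: filterS upos => k u0; have /phi_le /andP[p0 p1] := ltW u0.
    have un0 : 0 <= u k ^+ n.+1 by rewrite exprn_ge0// ltW.
    rewrite /cst !mulr_ge0 ?expR_ge0//= -mulrDl ler_wpM2r ?expR_ge0//.
    by rewrite (exprSr _ n.+1) -[X in _ <= X + _]mulr1 -mulrDr ler_wpM2l.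
  - exact: cvg_cst.
  - by rewrite -(addr0 0); apply: cvgD; exact: cvg_exprn_expRN.
rewrite -[_ * g]subr0.
have : (n.+1%:R + c) * gamma_partial n phi (u k) - u k ^+ n.+1 * phi (u k) * expR (- u k)
   @[k --> \oo] --> (n.+1%:R + c) * g - 0.
  by apply: cvgB => //; exact: cvgMr.
apply: cvg_trans; apply: near_eq_cvg.
by apply: filterS upos => k u0; rewrite (gamma_partial_step n cphi dphi).
Qed.

(** Squares serve as cutoffs because t = s^2 maps [0, k] onto [0, k^2], which matches the Gaussian
    integral over [0, k]. *)
Let sq k : R := (k ^ 2)%:R.

Let sq_cvg : sq k @[k --> \oo] --> +oo.
Proof.
apply/cvgryPge => A; apply: filterS (nbhs_infty_ger A) => k /le_trans; apply.
by rewrite ler_nat -mulnn; case: k => // k; rewrite leq_pmull.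
Qed.

(** The integrand is nonnegative, so its integrals over [0, k] converge to the integral over the
    half-line; this is read along the subsequence of squares. *)
Lemma Gamma_partial_cvg n phi g s : 0 < s -> continuous phi ->
  (forall t, 0 <= t -> t `^ (s - 1) = t ^+ n * phi t) ->
  gamma_partial n phi (sq k) @[k --> \oo] --> g -> Gamma s = g.
Proof.
move=> s0 cphi sphi Jg.
pose f t : R := t `^ (s - 1) * expR (- t).
have f0 t : 0 <= f t by rewrite mulr_ge0 ?powR_ge0 ?expR_ge0.
have mf : measurable_fun setT f.
  apply: measurable_funM; first exact: measurable_powR.
  by apply: measurableT_comp => //; exact: measurable_expR.
rewrite /Gamma /Rintegral integral_itv_obnd_cbnd; last first.
  by apply/measurable_EFinP; exact: measurable_funTS.
suff -> : (\int[mu]_(x in `[0%R, +oo[) (f x)%:E)%E = g%:E by [].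
have sqn : (k ^ 2)%N @[k --> \oo] --> \oo by apply/(@cvgrnyP R); exact: sq_cvg.
have := cvg_comp _ _ sqn (@ge0_cvgn_integral R mu f f0 mf).
move=> /cvg_lim => /(_ (@ereal_hausdorff R)) <-.
apply/cvg_lim; first exact: ereal_hausdorff.
rewrite (_ : _ \o _ = EFin \o (fun k => gamma_partial n phi (sq k))).
  by apply: cvg_EFin => //; apply: nearW.
apply/funext => k /=.
transitivity (\int[mu]_(x in `[0%R, (sq k)]) (x ^+ n * phi x * expR (- x))%:E)%E.
  apply: eq_integral => x /[!inE]/= /[!in_itv]/= /andP[x0 _].
  by rewrite /f sphi.
rewrite /gamma_partial /Rintegral fineK//.
apply: integrable_fin_num => //.
by apply: continuous_integrable_itv; exact: cont_integrand.
Qed.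

Lemma Gamma_natS n : Gamma n.+1%:R = n`!%:R :> R.
Proof.
have c1 : continuous (cst 1 : R -> R) by move=> x; exact: cst_continuous.
suff : gamma_partial n (cst 1) (sq k) @[k --> \oo] --> (n`!%:R : R).
  apply: Gamma_partial_cvg => // t t0.
  by rewrite mulr1 -natr1 addrK powR_mulrn.
elim: n => [|n IH].
  have : 1 - sq k ^+ 0 * expR (- sq k) @[k --> \oo] --> (1 - 0 : R).
    by apply: cvgB; [exact: cvg_cst|exact: cvg_exprn_expRN].
  rewrite subr0; apply: cvg_trans; apply: near_eq_cvg.
  have /cvgryPge/(_ 1) := sq_cvg; apply: filterS => k u1.
  have u0 : 0 < sq k by rewrite (lt_le_trans _ u1).
  pose F t : R := - expR (- t).
  have dF (t : R) : is_derive t 1 F (t ^+ 0 * cst 1 t * expR (- t)).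
    have := is_derive1_comp (is_derive_expR (- t)) (is_deriveNid t (1 : R)).
    move=> /is_deriveN; rewrite mulrN1 opprK => h.
    by apply: (is_derive_eq h); rewrite !mul1r.
  rewrite /gamma_partial (_ : \int[mu]_(t in _) _ = F (sq k) - F 0).
    by rewrite /F oppr0 expR0 expr0; lra.
  apply: Rintegral_FTC2 => //.
    exact: cont_integrand.
  by move=> t; apply/differentiable_continuous/derivable1_diffP; have [] := dF t.
have p1 (t : R) : 0 <= t -> 0 <= (cst 1 : R -> R) t <= 1 + t.
  by move=> t0; rewrite ler01 lerDl.
have d1 (t : R) : 0 < t -> is_derive t 1 (cst 1 : R -> R) (0 * (cst 1 : R -> R) t / t).
  by move=> t0; rewrite !mul0r; exact: is_derive_cst.
have h := cvg_gamma_partial_step sq_cvg c1 p1 d1 IH.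
by rewrite factS natrM; rewrite addr0 in h.
Qed.

Lemma cvg_integral_gauss :
  (\int[mu]_(t in `[0, k%:R]) gauss_fun t) @[k --> \oo] --> (Num.sqrt pi / 2 : R).
Proof.
have := @ge0_cvgn_integral R mu _ (@gauss_fun_ge0 R) (@measurable_gauss_fun R).
rewrite integral0y_gauss => h; exact: fine_cvg h.
Qed.

Let dsqrt (t : R) : 0 < t -> is_derive t 1 Num.sqrt (2^-1 * Num.sqrt t / t).
Proof.
move=> t0; apply: (is_derive_eq (is_derive1_sqrt t0)).
have s0 : Num.sqrt t != 0 by rewrite gt_eqF// sqrtr_gt0.
by rewrite -[X in _ / X](sqr_sqrtr (ltW t0)); field.
Qed.

(** The substitution t = s^2 gives the integral of 2 s^2 e^(-s^2) over [0, k]; integration by parts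
    turns it into the Gaussian integral minus k e^(-k^2), which tends to 0. *)
Let gamma_partial_sqrt0 :
  gamma_partial 0 Num.sqrt (sq k) @[k --> \oo] --> (Num.sqrt pi / 2 : R).
Proof.
have h1 : k%:R ^+ 1 * expR (- k%:R) @[k --> \oo] --> (0 : R).
  by apply: cvg_exprn_expRN; exact: cvgr_idn.
have h2 : k%:R * expR (- k%:R ^+ 2) @[k --> \oo] --> (0 : R).
  apply: (squeeze_cvgr _ _ h1); last exact: cvg_cst.
  apply: nearW => k; rewrite mulr_ge0 ?expR_ge0//= expr1 ler_wpM2l// ler_expR lerN2.
  by rewrite -natrX ler_nat -mulnn; case: k => // k; rewrite leq_pmull.
have : (\int[mu]_(t in `[0, k%:R]) gauss_fun t) - k%:R * expR (- k%:R ^+ 2)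
    @[k --> \oo] --> (Num.sqrt pi / 2 - 0 : R).
  exact: (cvgB cvg_integral_gauss h2).
rewrite subr0; apply: cvg_trans.
apply: near_eq_cvg; near=> k.
have k0 : 0 < k%:R :> R by rewrite ltr0n; near: k; exact: nbhs_infty_gt.
pose G (t : R) := t ^+ 0 * Num.sqrt t * expR (- t).
have cG : continuous G by apply: cont_integrand; exact: sqrt_continuous.
have d2 : (fun t : R => t ^+ 2)^`()%classic = (fun t => 2 * t).
  by apply/funext => x; rewrite derive1E exp_derive expr1 /GRing.scale/= mulr1.
have c2 : continuous (fun t : R => 2 * t).
  by move=> t; exact: (continuousM (@cst_continuous _ _ _ _) (@cvg_id _ _)).
have -> : gamma_partial 0 Num.sqrt (sq k) =
  \int[mu]_(t in `[0, k%:R]) (2 * (t ^+ 2 * gauss_fun t)).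
  rewrite /gamma_partial /Rintegral; congr fine.
  have := @integration_by_substitution_increasing R (fun t => t ^+ 2) G 0 k%:R.
  rewrite expr0n/= d2 -natrX -/(sq k) => ->.
  - apply: eq_integral => x /[!inE]/= /[!in_itv]/= /andP[x0 _]; congr EFin.
    by rewrite !fctE /G expr0 mul1r sqrtr_sqr ger0_norm// /gauss_fun; ring.
  - exact: ltW.
  - move=> x y /[!in_itv]/= /andP[x0 _] /andP[y0 _] xy.
    by rewrite ltr_sqr ?nnegrE.
  - by move=> x _; exact: c2.
  - by apply: cvgP; apply: cvg_at_right_filter; exact: c2.
  - by apply: cvgP; apply: cvg_at_left_filter; exact: c2.
  - split.
    + by move=> x _; exact: exprn_derivable.
    + by apply: cvg_at_right_filter; exact: exprn_continuous.
    + by apply: cvg_at_left_filter; exact: exprn_continuous.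
  - exact: continuous_subspaceT.
(* Its derivative is the difference between the substituted integrand and the Gaussian. *)
pose F (t : R) := - t * gauss_fun t.
have dF (t : R) : is_derive t 1 F (2 * (t ^+ 2 * gauss_fun t) - gauss_fun t).
  have dg : is_derive t 1 gauss_fun (expR (- t ^+ 2) * - (t *+ 2)).
    have d := is_deriveN (is_deriveX 2 (is_derive_id t (1 : R))).
    apply: (is_derive_eq (is_derive1_comp (is_derive_expR _) d)).
    by rewrite /GRing.scale/= mulr1 mulr_natl.
  apply: (is_derive_eq (is_deriveM (is_deriveNid t (1 : R)) dg)).
  by rewrite /GRing.scale/= /gauss_fun; ring.
have cF : continuous F.
  by move=> t; apply/differentiable_continuous/derivable1_diffP; have [] := dF t.
have cg2 : continuous (fun t : R => 2 * (t ^+ 2 * gauss_fun t)).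
  move=> t; have cx := @exprn_continuous R 2 t.
  exact: (continuousM (@cst_continuous _ _ _ _) (continuousM cx (@continuous_gauss_fun _ t))).
have := @Rintegral_FTC2 R _ F 0 k%:R k0 _ cF (fun t _ => dF t).
rewrite RintegralB//; last 2 first.
- exact: continuous_integrable_itv.
- by apply: continuous_integrable_itv; exact: continuous_gauss_fun.
rewrite {2}/F oppr0 mul0r subr0 /F /gauss_fun => e.
rewrite -[RHS](subrK (\int[mu]_(t in `[0, k%:R]) gauss_fun t)).
rewrite e; first by ring.
move=> t; exact: (continuousB (cg2 t) (@continuous_gauss_fun _ t)).
Unshelve. all: by end_near.
Qed.

Let Gamma_sqrt_cvg n g : gamma_partial n Num.sqrt (sq k) @[k --> \oo] --> g ->
  Gamma (n%:R + 3 / 2) = g.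
Proof.
apply: Gamma_partial_cvg; [by rewrite ltr_wpDl|exact: sqrt_continuous|move=> t t0].
have -> : n%:R + 3 / 2 - 1 = n%:R + 2^-1 :> R by field.
rewrite powRD; last by rewrite gt_eqF// ltr_wpDl.
by rewrite powR_mulrn// powR12_sqrt.
Qed.

Let cvg_gamma_partial_sqrtS n g :
  gamma_partial n Num.sqrt (sq k) @[k --> \oo] --> g ->
  gamma_partial n.+1 Num.sqrt (sq k) @[k --> \oo] --> (n%:R + 3 / 2) * g.
Proof.
have -> : n%:R + 3 / 2 = n.+1%:R + 2^-1 :> R by rewrite -natr1; field.
move=> IH; apply: (cvg_gamma_partial_step sq_cvg _ _ dsqrt IH); first exact: sqrt_continuous.
move=> t t0; rewrite sqrtr_ge0/= -ler_sqr ?nnegrE ?sqrtr_ge0 ?addr_ge0// sqr_sqrtr//.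
nra.
Qed.

(** [Gamma] names its own limit here: the step lemma supplies convergence, and [Gamma_sqrt_cvg]
    identifies the limit, which yields the functional equation below. *)
Let cvg_gamma_partial_sqrt n :
  gamma_partial n Num.sqrt (sq k) @[k --> \oo] --> Gamma (n%:R + 3 / 2 : R).
Proof.
elim: n => [|n IH].
  by rewrite (Gamma_sqrt_cvg gamma_partial_sqrt0); exact: gamma_partial_sqrt0.
by have h := cvg_gamma_partial_sqrtS IH; rewrite (Gamma_sqrt_cvg h).
Qed.

Lemma Gamma_3half : Gamma (3 / 2 : R) = Num.sqrt pi / 2.
Proof. by rewrite -(Gamma_sqrt_cvg gamma_partial_sqrt0) add0r. Qed.

Lemma Gamma_half_rec n :
  Gamma (n.+1%:R + 3 / 2 : R) = (n%:R + 3 / 2) * Gamma (n%:R + 3 / 2).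
Proof. exact: Gamma_sqrt_cvg (cvg_gamma_partial_sqrtS (@cvg_gamma_partial_sqrt n)). Qed.

End GammaValues.

(** * Zonal harmonics: total mass, pointwise lower bound, eigenvalues of P_(r,N) *)

Section Zonal.
Context {R : realType}.
Notation mu := (@lebesgue_measure R).
Variable m : nat.
Let N := m.*2.+3.
Let l : R := (N%:R - 1) / 2.
Let W : R := wint N (fun=> 1).
Implicit Types (p : {poly R}) (k : nat) (x : R).

(** Both sides equal pi / 2 for N = 3 and obey the same recursion from N to N + 2. This recognizes
    the Gamma quotients in the functional as W and its inverse. *)
Lemma wint1E : W = Num.sqrt pi * Gamma (N%:R / 2) / Gamma ((N%:R + 1) / 2).
Proof.
rewrite /W /N.
have e0 k : k.*2.+3%:R / 2 = k%:R + 3 / 2 :> R.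
  by rewrite -addn3 natrD -muln2 natrM; field.
have e1 k : (k.*2.+3%:R + 1) / 2 = k.+2%:R :> R.
  by rewrite -addn3 -[in RHS]addn2 !natrD -muln2 natrM; field.
elim: m => [|k IH].
  rewrite e0 e1 add0r Gamma_3half Gamma_natS divr1 mulrA -expr2 sqr_sqrtr ?pi_ge0//.
  rewrite -Rintegral_sqrt_disk; apply: eq_Rintegral => x /[!inE] xI.
  by rewrite mulr1 (weightE 0 xI) expr0 mul1r.
rewrite e0 e1 in IH; rewrite e0 e1 Gamma_half_rec Gamma_natS factS natrM.
have := @wint1_rec R k; rewrite IH Gamma_natS.
have -> : k.*2.+3.+1%:R = 2 * k.+2%:R :> R by rewrite -natrM mul2n.
have -> : k.*2.+3%:R = 2 * (k%:R + 3 / 2) :> R.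
  by rewrite -e0; field.
rewrite -[k.+1.*2.+3]/(k.*2.+3.+2) => h.
apply: (@mulfI _ (2 * k.+2%:R)); first by rewrite mulf_neq0.
have f0 : k.+1`!%:R != 0 :> R by rewrite pnatr_eq0 -lt0n fact_gt0.
rewrite h; move: (k.+1`!%:R : R) f0 => f f0.
have k0 : k.+2%:R != 0 :> R by [].
by move: (k.+2%:R : R) k0 => kk k0; field; rewrite f0 k0.
Qed.

Lemma wint1_gt0 : 0 < W.
Proof.
rewrite /W /N; elim: m => [|k IH].
  have -> : wint 3 (fun=> 1) = pi / 2 :> R.
    rewrite -Rintegral_sqrt_disk; apply: eq_Rintegral => x /[!inE] xI.
    by rewrite mulr1 (weightE 0 xI) expr0 mul1r.
  by rewrite divr_gt0// pi_gt0.
by rewrite -(pmulr_rgt0 _ (ltr0Sn R k.*2.+3)) wint1_rec mulr_gt0.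
Qed.

Let l_gt0 : 0 < l.
Proof. by rewrite divr_gt0// subr_gt0 ltr1n. Qed.

Let two_l : 2 * l = N%:R - 1. Proof. by rewrite /l; field. Qed.

Lemma zonal1 k : (zonal N k).[1] = 1 :> R.
Proof. by rewrite /zonal hornerZ mulVf// gt_eqF// gegenbauer1_gt0. Qed.

Lemma zonal0 : zonal N 0 = 1 :> {poly R}.
Proof. by rewrite /zonal /= hornerC invr1 scale1r. Qed.

Lemma zonalN k x : (zonal N k).[- x] = (-1) ^+ k * (zonal N k).[x].
Proof. by rewrite /zonal !hornerZ gegenbauerN mulrCA. Qed.

Lemma zonal_orthogonal j k : j != k ->
  wint N (fun x : R => (zonal N j).[x] * (zonal N k).[x]) = 0.
Proof.
move=> jk; pose c i : R := (gegenbauer l i).[1]^-1.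
transitivity (wint N (fun x => c j * c k * (gegenbauer l j * gegenbauer l k).[x])).
  by apply: eq_wint => x _; rewrite /zonal !hornerZ hornerM /c /l; ring.
by rewrite wintZ; [rewrite gegenbauer_orthogonal// mulr0|exact: continuous_horner].
Qed.

Lemma zonal_ode k (F : {poly R} := zonal N k) :
  (1 - 'X^2) * F^`()^`() - N%:R%:P * 'X * F^`()
  + (k%:R * (k%:R + N%:R - 1))%:P * F = 0.
Proof.
have := gegenbauer_ode l k; rewrite two_l subrK addrA.
rewrite /F /zonal -/l; set C := gegenbauer l k => ode.
by rewrite !derivZ -!scalerAr -scalerBr -scalerDr ode scaler0.
Qed.

(** Differentiating the equation of F gives one of the same type for F', with constants N + 2 and k
    (k+N-1) - N; the latter is positive because k > 1. Sonin's bound then gives |F'| <= F'(1) on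
    [0, 1], the equation at x = 1 gives F'(1) = k (k+N-1) / N, and the mean value theorem
    concludes. *)
Lemma zonal_ge k x : (1 < k)%N -> 0 <= x <= 1 ->
  1 - k%:R * (k%:R + N%:R - 1) / N%:R * (1 - x) <= (zonal N k).[x].
Proof.
move=> k1 /andP[x0 x1]; set F : {poly R} := zonal N k.
set b : R := k%:R * (k%:R + N%:R - 1).
have ode := zonal_ode k; rewrite -/F -/b in ode.
have k2 : 2 <= k%:R :> R by rewrite ler_nat.
have N3 : 3 <= N%:R :> R by rewrite ler_nat.
have ode' : (1 - 'X^2) * F^`()^`()^`() - (N%:R + 2)%:P * 'X * F^`()^`()
    + (b - N%:R)%:P * F^`() = 0.
  have := congr1 (@deriv R) ode.
  rewrite deriv0 !(derivD, derivN, derivM, derivC, derivX, derivXn)/= => <-.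
  by move: (N%:R : R) => n; rewrite !polyCD polyCN; ring.
have F1 : F^`().[1] = b / N%:R.
  have := congr1 (horner^~ 1) ode.
  rewrite !(hornerD, hornerN, hornerM, hornerX, hornerXn, hornerC) zonal1.
  move=> h; have N0 : N%:R != 0 :> R by rewrite pnatr_eq0.
  by apply: (mulfI N0); rewrite mulrCA mulfV// mulr1; lra.
have F1_ge0 : 0 <= F^`().[1].
  by rewrite F1 divr_ge0// mulr_ge0//; lra.
move: x1; rewrite le_eqVlt => /predU1P[->|x1].
  by rewrite subrr mulr0 subr0 zonal1.
have [c /[!in_itv]/= /andP[xc c1] EE] := poly_mvt F x1.
rewrite zonal1 in EE.
have Fc : F^`().[c] <= F^`().[1].
  apply: (le_trans (ler_norm _)); rewrite -[leRHS]ger0_norm//.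
  apply: (sonin_bound _ _ ode').
  - lra.
  - by rewrite /b; nra.
  - by rewrite (le_trans x0 (ltW xc)) ltW.
have : F^`().[c] * (1 - x) <= b / N%:R * (1 - x).
  by rewrite -F1 ler_wpM2r// subr_ge0 ltW.
rewrite -EE; lra.
Qed.

Lemma P_eigenvalueE k : (0 < k)%N ->
  P_eigenvalue N k = (k + N.-1)`!%:R / k.-1`!%:R :> R.
Proof.
case: k => // k _; rewrite /P_eigenvalue (_ : (k.+1 + N)%N = (k.+1 + N.-1).+1).
  by rewrite !Gamma_natS.
by rewrite -addnS.
Qed.

(** The factorials of the eigenvalue cancel those of the norm. The remaining ratio (2k+N-1) / (k
    (k+N-1)) splits as 1/k + 1/(k+N-1), the source of the logarithmic growth. *)
Lemma P_eigenvalue_norm k : (0 < k)%N ->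
  P_eigenvalue N k * zonal_norm2 N k * (2 * k%:R + N%:R - 1) =
  k%:R * (k%:R + N%:R - 1) * ((N.-1)`!%:R * W).
Proof.
move=> k0; rewrite P_eigenvalueE//.
have := @zonal_norm2_closed R m k; rewrite -/N -/W.
have -> : (k.*2 + N - 1)%:R = 2 * k%:R + N%:R - 1 :> R.
  by rewrite natrB; [rewrite natrD -muln2 natrM mulrC|rewrite addnS].
have -> : (k + N.-1)`!%:R = (k%:R + N%:R - 1) * (k + N - 2)`!%:R :> R.
  rewrite (_ : k + N.-1 = (k + N - 2).+1)%N; last by rewrite /N; lia.
  rewrite factS natrM (_ : (k + N - 2).+1 = (k + N - 1)%N); last by rewrite /N; lia.
  by rewrite natrB; [rewrite natrD|rewrite addnS].
have -> : k`!%:R = k%:R * k.-1`!%:R :> R by rewrite -natrM -[in RHS](prednK k0) -factS prednK.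
have f0 : k.-1`!%:R != 0 :> R by rewrite pnatr_eq0 -lt0n fact_gt0.
move: (k.-1`!%:R : R) f0 ((k + N - 2)`!%:R : R) (zonal_norm2 N k : R)
  ((N.-1)`!%:R : R) W (k%:R : R) (N%:R : R) => f f0 f2 h f1 w kk n e.
apply: (mulfI f0).
transitivity ((kk + n - 1) * (h * f2 * (2 * kk + n - 1))); first by field.
by rewrite e; ring.
Qed.

Lemma zonal_norm2_neq0 k : zonal_norm2 N k != 0 :> R.
Proof.
have f0 j : 0 < j`!%:R :> R by rewrite ltr0n fact_gt0.
apply/eqP => h0; have := @zonal_norm2_closed R m k; rewrite -/N h0 !mul0r => e.
have := mulr_gt0 (mulr_gt0 (f0 k) (f0 N.-1)) wint1_gt0.
by rewrite -e ltxx.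
Qed.

Lemma wint_sum K (f : nat -> R -> R) : (forall i, continuous (f i)) ->
  wint N (fun x => \sum_(i < K) f i x) = \sum_(i < K) wint N (f i).
Proof.
move=> cf; elim: K => [|K IH].
  rewrite big_ord0 -[LHS]/(wint N (fun x => \sum_(i < 0) f i x)).
  transitivity (wint N (fun x : R => 0 * 1)).
    by apply: eq_wint => x _; rewrite big_ord0 mul0r.
  by rewrite wintZ ?mul0r// => x; exact: cst_continuous.
have cs : continuous (fun x => \sum_(i < K) f i x).
  elim: K {IH} => [|K IH] x; first by under eq_fun do rewrite big_ord0; exact: cst_continuous.
  by under eq_fun do rewrite big_ord_recr; exact: continuousD (IH x) (cf K x).
rewrite big_ord_recr /= -IH -wintD; [|exact: cs|exact: cf].
by apply: eq_wint => x _; rewrite big_ord_recr.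
Qed.

End Zonal.

(** * Finite sums of zonal harmonics as test functions *)

Lemma cvg_series_finite_support {R : realType} (v : R^nat) K :
  (forall k, (K <= k)%N -> v k = 0) -> series v @ \oo --> \sum_(k < K) v k.
Proof.
move=> v0; apply: cvg_near_cst; near=> n.
have Kn : (K <= n)%N by near: n; exact: nbhs_infty_ge.
rewrite /series/= (big_cat_nat (leq0n K) Kn)/=.
rewrite [X in _ + X]big_nat_cond [X in _ + X]big1 ?addr0 ?big_mkord//.
by move=> i /andP[/andP[Ki _] _]; exact: v0.
Unshelve. all: by end_near. Qed.

Section ZonalSum.
Context {R : realType}.
Notation mu := (@lebesgue_measure R).
Variable m : nat.
Let N := m.*2.+3.
Variables (K : nat) (c : nat -> R).
Implicit Types (k : nat) (x : R).

Definition zonal_sum n := \sum_(k < K) c k *: zonal n k.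
Let p := zonal_sum N.

Lemma horner_zonal_sum n x : (zonal_sum n).[x] = \sum_(k < K) c k * (zonal n k).[x].
Proof.
by rewrite /zonal_sum horner_sum; apply: eq_bigr => k _; rewrite hornerZ.
Qed.

Let wint_zonal_sumM k : wint N (fun x => p.[x] * (zonal N k).[x]) =
  \sum_(i < K) c i * wint N (fun x => (zonal N i).[x] * (zonal N k).[x]).
Proof.
have cM i : continuous (fun x : R => (zonal N i).[x] * (zonal N k).[x]).
  by move=> x; exact: (continuousM (@continuous_horner _ _ x) (@continuous_horner _ _ x)).
transitivity (wint N (fun x => \sum_(i < K) c i * ((zonal N i).[x] * (zonal N k).[x]))).
  apply: eq_wint => x _; rewrite horner_zonal_sum mulr_suml.
  by apply: eq_bigr => i _; rewrite mulrA.
rewrite (@wint_sum R m K (fun i x => c i * ((zonal N i).[x] * (zonal N k).[x]))).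
  by apply: eq_bigr => i _; rewrite wintZ.
by move=> i x; exact: (continuousM (@cst_continuous _ _ _ _) (cM i x)).
Qed.

Lemma zonal_coef_sum k : zonal_coef N (horner p) k = if (k < K)%N then c k else 0.
Proof.
rewrite /zonal_coef wint_zonal_sumM; case: ltnP => kK.
  rewrite (bigD1 (Ordinal kK))//= big1 ?addr0; last first.
    by move=> i ik; rewrite zonal_orthogonal ?mulr0.
  rewrite -mulrA [X in _ * X](_ : _ = 1) ?mulr1// -(mulfV (zonal_norm2_neq0 m k)).
  by congr (_ / _); apply: eq_wint => x _; rewrite expr2.
rewrite big1 ?mul0r// => i _; rewrite zonal_orthogonal ?mulr0//.
by rewrite ltn_eqF// (leq_trans _ kK).
Qed.

Lemma P_form_zonal_sum :
  P_form N (horner p) = \sum_(k < K) P_eigenvalue N k * c k ^+ 2 * zonal_norm2 N k.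
Proof.
rewrite /P_form; apply/cvg_lim => //.
rewrite (eq_bigr (fun k : 'I_K =>
  P_eigenvalue N k * zonal_coef N (horner p) k ^+ 2 * zonal_norm2 N k)).
  apply: (@cvg_series_finite_support _ _ K) => k Kk.
  by rewrite zonal_coef_sum ltnNge Kk/= expr0n mulr0 mul0r.
by move=> k _; rewrite zonal_coef_sum ltn_ord.
Qed.

Lemma axial_sobolev_zonal_sum s : axial_sobolev N s (horner p).
Proof.
split; first split.
- apply: measurable_funTS; apply: continuous_measurable_fun.
  exact: continuous_horner.
- apply: wint_integrable => x.
  have cp := @continuous_horner _ p x.
  exact: (continuousM cp cp).
- apply: cvgP; apply: (@cvg_series_finite_support _ _ K) => k Kk.
  by rewrite zonal_coef_sum ltnNge Kk/= expr0n mulr0 mul0r.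
Qed.

Lemma wint_zonal_sum : c 0 = 0 -> wint N (horner p) = 0.
Proof.
move=> c0; transitivity (wint N (fun x => p.[x] * (zonal N 0).[x])).
  by apply: eq_wint => x _; rewrite zonal0 hornerC mulr1.
rewrite wint_zonal_sumM big1// => -[[|i] iK] _ /=; first by rewrite c0 mul0r.
by rewrite zonal_orthogonal ?mulr0.
Qed.

Lemma zonal_sum_even x : (forall k, odd k -> c k = 0) -> p.[- x] = p.[x].
Proof.
move=> c0; rewrite !horner_zonal_sum; apply: eq_bigr => k _.
by rewrite zonalN -signr_odd; case: (boolP (odd k)) => [/c0 ->|]; rewrite ?mul0r ?mul1r.
Qed.

(** With even degrees only, the sum is an even function, so the integrand x e^(N u) of the centering
    constraint is odd. *)
Lemma L_r_zonal_sum : (forall k, odd k -> c k = 0) -> L_r N (horner p).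
Proof.
move=> c0; split; first exact: axial_sobolev_zonal_sum.
apply: wint_odd => x; last by rewrite zonal_sum_even// mulNr.
apply: (@continuousM _ _ id (fun x => expR (N%:R * p.[x]))); first exact: cvg_id.
apply: (@continuous_comp _ _ _ (fun x => N%:R * p.[x]) expR); last exact: continuous_expR.
exact: (continuousM (@cst_continuous _ _ _ _) (@continuous_horner _ p x)).
Qed.

End ZonalSum.

Lemma sum_even_indices (V : nmodType) (f : nat -> V) n :
  \sum_(k < n.*2.+1) (if odd k || (k == 0 :> nat) then 0 else f k) =
  \sum_(j < n) f j.+1.*2.
Proof.
elim: n => [|n IH]; first by rewrite big_ord1 big_ord0.
rewrite doubleS 2!big_ord_recr/= IH odd_double/= addr0.
by rewrite big_ord_recr.
Qed.

(** * Lower bounds for weighted integrals by restriction to a subinterval *)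

Section LowerBounds.
Context {R : realType}.
Notation mu := (@lebesgue_measure R).
Variable m : nat.
Let N := m.*2.+3.
Implicit Types (f : R -> R) (s t x a : R).

Lemma wint_ge_itv f s t a : continuous f -> (forall x, 0 <= f x) ->
  -1 <= s -> s <= t -> t <= 1 ->
  (forall x, s <= x <= t -> a <= weight N x * f x) ->
  a * (t - s) <= wint N f.
Proof.
move=> cf f0 s1 st t1 af.
have sub : `[s, t] `<=` `[-1, 1]%classic.
  by move=> x /=; rewrite !in_itv/= => /andP[? ?]; apply/andP; split; lra.
have int1 := wint_integrable m cf; rewrite -/N in int1.
have int2 : mu.-integrable `[s, t] (EFin \o (fun x => weight N x * f x)).
  by apply: integrableS int1.
apply: (@le_trans _ _ (\int[mu]_(x in `[s, t]) (weight N x * f x))).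
  have -> : a * (t - s) = \int[mu]_(x in `[s, t]) a.
    rewrite Rintegral_cst//= lebesgue_measure_itv/= lte_fin.
    by move: st; rewrite le_eqVlt => /predU1P[->|->//]; rewrite ltxx subrr.
  apply: le_Rintegral => //.
  by apply: continuous_integrable_itv => x; exact: cst_continuous.
rewrite /wint /Rintegral fine_le//; [exact: integrable_fin_num..|].
apply: ge0_subset_integral => //; first by have /measurable_int := int1.
by move=> x _; rewrite lee_fin mulr_ge0 ?weight_ge0.
Qed.

End LowerBounds.

(** * The truncated two-pole Green function and its estimates *)

Section TestFunctions.
Context {R : realType}.
Variable m : nat.
Let N := m.*2.+3.
Let A : R := (N.-1)`!%:R * wint N (fun=> 1).
Implicit Types (j k n : nat) (x : R).

(* [A / green_coef k] is the product of the eigenvalue and of the squared norm,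
   so these are, up to [A], the coefficients of the Green function of P_(r,N)
   at the pole. *)
Definition green_coef k : R := k%:R^-1 + (k%:R + N%:R - 1)^-1.

Definition even_green_sum n : R := \sum_(j < n) green_coef j.+1.*2.

(* The Green function for a pair of antipodal poles, truncated in degree and
   multiplied by [A]. *)
Definition two_pole_poly n : {poly R} :=
  zonal_sum n.*2.+1 (fun k => if odd k || (k == 0%N) then 0 else 2 * green_coef k) N.

Lemma green_coef_eigenvalue k : (0 < k)%N ->
  P_eigenvalue N k * zonal_norm2 N k * green_coef k = A.
Proof.
move=> k0; have := @P_eigenvalue_norm R m k k0; rewrite -/N -/A /green_coef.
have k1 : 1 <= k%:R :> R by rewrite ler1n.
have N3 : 3 <= N%:R :> R by rewrite ler_nat.
move: (P_eigenvalue N k : R) (zonal_norm2 N k : R) A (k%:R : R) (N%:R : R) k1 N3.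
move=> e h a kk n k1 n3 eq.
have z1 : kk != 0 by rewrite gt_eqF//; lra.
have z2 : kk + n - 1 != 0 by rewrite gt_eqF//; lra.
apply: (mulfI (mulf_neq0 z1 z2)); rewrite -eq; field.
by rewrite z1 z2.
Qed.

Lemma P_form_two_pole_poly n :
  P_form N (horner (two_pole_poly n)) = 4 * A * even_green_sum n.
Proof.
rewrite P_form_zonal_sum.
transitivity (\sum_(k < n.*2.+1)
  (if odd k || (k == 0%N :> nat) then 0 else 4 * A * green_coef k)).
  apply: eq_bigr => k _; case: ifPn => [_|]; first by rewrite expr0n mulr0 mul0r.
  rewrite negb_or -lt0n => /andP[_ k0].
  by rewrite -(green_coef_eigenvalue k0); ring.
by rewrite (sum_even_indices (fun k => 4 * A * green_coef k)) -mulr_sumr.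
Qed.

(** Since a_k k (k+N-1) = 2k+N-1, the bound on F_k loses at most (2k+N-1) (1-x) / N in a_k F_k. For
    1 <= k <= 2n this is at most (N+4) n (1-x) / N; n terms with coefficient 2 lose 2 (N+4) / N in
    total once n^2 (1-x) <= 1. *)
Lemma two_pole_poly_ge n x : 0 <= x <= 1 -> n%:R ^+ 2 * (1 - x) <= 1 ->
  2 * even_green_sum n - 2 * (N%:R + 4) / N%:R <= (two_pole_poly n).[x].
Proof.
move=> x01 nx; have /andP[x0 x1] := x01.
have N3 : 3 <= N%:R :> R by rewrite ler_nat.
rewrite horner_zonal_sum.
apply: (@le_trans _ _ (\sum_(k < n.*2.+1) (if odd k || (k == 0%N :> nat) then 0
    else 2 * green_coef k - 2 * (N%:R + 4) / N%:R * (n%:R * (1 - x))))).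
  rewrite (sum_even_indices (fun k =>
    2 * green_coef k - 2 * (N%:R + 4) / N%:R * (n%:R * (1 - x)))).
  rewrite big_split/= -mulr_sumr lerD2l sumrN lerN2 sumr_const card_ord -[_ *+ n]mulr_natl.
  have -> : n%:R * (2 * (N%:R + 4) / N%:R * (n%:R * (1 - x))) =
    2 * (N%:R + 4) / N%:R * (n%:R ^+ 2 * (1 - x)) by ring.
  rewrite ler_piMr//; by rewrite divr_ge0//; lra.
apply: ler_sum => k _; case: ifPn => [_|]; first by rewrite mul0r.
rewrite negb_or -lt0n => /andP[ok k0].
(* A nonzero even degree is at least 2, as [zonal_ge] demands. *)
have k1 : (1 < k)%N by move: ok k0; case: (k : nat) => [|[|]].
have := zonal_ge m k1 x01; rewrite -/N.
have kn : k%:R <= 2 * n%:R :> R by rewrite -natrM ler_nat mul2n -ltnS.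
have n1 : 1 <= n%:R :> R.
  by rewrite ler1n; case: (n) k k0 {ok k1 kn} => // -[[|]].
have kk1 : 1 <= k%:R :> R by rewrite ler1n.
have g0 : 0 <= green_coef k.
  by rewrite addr_ge0// invr_ge0//; lra.
move=> /(ler_wpM2l g0).
have -> : green_coef k * (1 - k%:R * (k%:R + N%:R - 1) / N%:R * (1 - x)) =
  green_coef k - (2 * k%:R + N%:R - 1) / N%:R * (1 - x).
  rewrite /green_coef.
  have z1 : k%:R != 0 :> R by rewrite gt_eqF//; lra.
  have z2 : k%:R + N%:R - 1 != 0 :> R by rewrite gt_eqF//; lra.
  have z3 : N%:R != 0 :> R by rewrite gt_eqF//; lra.
  move: (k%:R : R) (N%:R : R) z1 z2 z3 => a b z1 z2 z3; field.
  by rewrite z1 z2 z3.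
have : (2 * k%:R + N%:R - 1) / N%:R * (1 - x) <=
    (N%:R + 4) / N%:R * (n%:R * (1 - x)).
  rewrite mulrA ler_wpM2r ?subr_ge0// mulrAC ler_pM2r ?invr_gt0; last by lra.
  by nra.
move: (green_coef k) (zonal N k).[x] => g F.
lra.
Qed.

(** As N - 1 = 2 (m+1), a_(2j) is half of 1/j + 1/(j+m+1). Both harmonic sums are compared with
    telescoping logarithms through ln (a+1) - ln a <= 1/a. *)
Lemma even_green_sum_ge n : (0 < n)%N ->
  ln n%:R - ln m.+2%:R / 2 <= even_green_sum n.
Proof.
move=> n0.
have step (a : R) : 0 < a -> ln (a + 1) - ln a <= a^-1.
  move=> a0; have -> : a + 1 = a * (1 + a^-1) by rewrite mulrDr mulr1 mulfV// gt_eqF.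
  rewrite lnM ?posrE ?addr_gt0 ?invr_gt0// [ln a + _]addrC addrK le_ln1Dx//.
  by rewrite (lt_trans (ltrN10 R))// invr_gt0.
(* This sharper bound is the exact telescoped sum, so the induction closes; it also holds at n =
   0. *)
suff h : (ln n.+1%:R + ln (n + m.+2)%:R - ln m.+2%:R) / 2 <= even_green_sum n.
  apply: le_trans h.
  have : ln n%:R <= ln n.+1%:R :> R by rewrite ler_ln ?posrE ?ltr0n// ler_nat.
  have : ln n%:R <= ln (n + m.+2)%:R :> R.
    by rewrite ler_ln ?posrE ?ltr0n ?ler_nat ?leq_addr ?addnS.
  lra.
elim: n {n0} => [|n IH].
  by rewrite /even_green_sum big_ord0 ln1 add0n add0r subrr mul0r.
rewrite /even_green_sum big_ord_recr/= -/(even_green_sum n).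
have s1 := step n.+1%:R (ltr0Sn _ _).
have s2 := step (n + m.+2)%:R; rewrite ltr0n addnS in s2.
have {}s2 := s2 isT; rewrite -addnS in s2.
have e1 : n.+2%:R = n.+1%:R + 1 :> R by rewrite natr1.
have e2 : (n.+1 + m.+2)%:R = (n + m.+2)%:R + 1 :> R by rewrite addSn natr1.
have -> : green_coef n.+1.*2 = (n.+1%:R^-1 + (n + m.+2)%:R^-1) / 2.
  have d1 : n.+1.*2%:R = 2 * n.+1%:R :> R by rewrite -natrM mul2n.
  have d2 : n.+1.*2%:R + N%:R - 1 = 2 * (n + m.+2)%:R :> R.
    rewrite -natrD (_ : (n.+1.*2 + N)%N = (2 * (n + m.+2)).+1).
      by rewrite -natr1 addrK natrM.
    by rewrite /N; lia.
  by rewrite /green_coef d2 d1 !invfM; ring.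
rewrite e1 e2; move: IH s1 s2; clear.
move: (n.+1%:R : R) ((n + m.+2)%:R : R) (ln m.+2%:R : R) => a b c.
by move: (ln a) (ln (a + 1)) (ln b) (ln (b + 1)) a^-1 b^-1 (even_green_sum n) => *; lra.
Qed.

(** Only the interval [1 - 2d, 1 - d] is kept. There 1 - x^2 >= d bounds the weight below by
    d^((N-2)/2), and n^2 (1-x) <= 2 n^2 d = 1 gives the pointwise bound; the length d of the
    interval raises the power to N/2. *)
Lemma wint_exp_two_pole_poly_ge n (d : R) : (0 < n)%N -> d = (2 * n%:R ^+ 2)^-1 ->
  d `^ (N%:R / 2) * expR (N%:R * (2 * even_green_sum n - 2 * (N%:R + 4) / N%:R)) <=
  wint N (fun x => expR (N%:R * (two_pole_poly n).[x])).
Proof.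
move=> n0 dE; set M := 2 * _ - _.
have n1 : 1 <= n%:R ^+ 2 :> R by rewrite -natrX ler1n expn_gt0 n0.
have d0 : 0 < d by rewrite dE invr_gt0; lra.
have nd : n%:R ^+ 2 * d = 2^-1.
  by rewrite dE invfM mulrCA mulfV ?mulr1// gt_eqF//; lra.
have d12 : d <= 2^-1 by rewrite -nd ler_peMl// ltW.
have -> : N%:R / 2 = (N%:R - 2) / 2 + 1 :> R by field.
rewrite powRD; last by rewrite (gt_eqF d0) implybT.
rewrite powRr1 ?(ltW d0)// mulrAC.
(* Exhibits the remaining factor d as the length of the interval of integration. *)
have {2}-> : d = (1 - d) - (1 - 2 * d) by ring.
apply: wint_ge_itv.
- move=> x; apply: (@continuous_comp _ _ _ (fun x => N%:R * (two_pole_poly n).[x]) expR).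
    exact: (continuousM (@cst_continuous _ _ _ _) (@continuous_horner _ (two_pole_poly n) x)).
  exact: continuous_expR.
- by move=> x; exact: expR_ge0.
- lra.
- lra.
- lra.
move=> x /andP[xs xt].
apply: ler_pM; rewrite ?powR_ge0 ?expR_ge0//.
  apply: ge0_ler_powR; rewrite ?nnegrE.
  - by rewrite divr_ge0// subr_ge0 ler_nat.
  - exact: ltW.
  - nra.
  - nra.
rewrite ler_expR ler_wpM2l//; apply: two_pole_poly_ge; first by apply/andP; split; lra.
nra.
Qed.

End TestFunctions.

(** * From nonnegativity of the functional to the bound on alpha *)

Lemma ln_bound_of_I_ge0 (R : realType) (m n : nat) (alpha : R)
    (N := m.*2.+3) (W : R := wint N (fun=> 1)) (d : R := (2 * n%:R ^+ 2)^-1) :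
  (0 < n)%N -> 0 <= I_functional alpha N (horner (two_pole_poly m n)) ->
  N%:R / 2 * ln d + N%:R * (2 * even_green_sum m n - 2 * (N%:R + 4) / N%:R) - ln W
  <= 2 * alpha * N%:R * even_green_sum m n.
Proof.
move=> n0; rewrite /I_functional P_form_two_pole_poly wint_zonal_sum// mulr0 addr0.
have W0 : 0 < W by exact: wint1_gt0.
have := @wint1E R m; rewrite -/N -/W.
set s := Num.sqrt pi; set G := Gamma _; set G' := Gamma _ => WE.
(* Once the Gamma quotients are expressed by W, the logarithm is that of the weighted average of
   e^(N u). *)
have -> : (N.-1)`!%:R * s * G / (N%:R * G') = (N.-1)`!%:R * W / N%:R.
  by rewrite WE invfM; ring.
have -> : G' / (s * G) = W^-1 by rewrite WE invf_div.
have d0 : 0 < d by rewrite invr_gt0 mulr_gt0// exprn_gt0// ltr0n.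
have := @wint_exp_two_pole_poly_ge R m n d n0 erefl; rewrite -/N.
set E := wint N _; set M := _ - _ => EM.
have E0 : 0 < E by rewrite (lt_le_trans _ EM)// mulr_gt0 ?powR_gt0 ?expR_gt0.
have lnE : N%:R / 2 * ln d + N%:R * M <= ln E.
  rewrite -ln_powR -[X in _ + X]expRK -lnM ?posrE ?powR_gt0 ?expR_gt0//.
  by rewrite ler_ln ?posrE// mulr_gt0 ?powR_gt0 ?expR_gt0.
rewrite lnM ?posrE ?invr_gt0// lnV ?posrE//.
have f0 : 0 < (N.-1)`!%:R :> R by rewrite ltr0n fact_gt0.
move: lnE; set P := _ + _; set L := even_green_sum _ _; move: P => P lnE h.
have N0 : 0 < N%:R :> R by rewrite ltr0n.
have : (N.-1)`!%:R * W / N%:R * (- ln W + ln E) <=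
    (N.-1)`!%:R * W / N%:R * (2 * alpha * N%:R * L).
  rewrite -subr_ge0; apply: le_trans h _; rewrite le_eqVlt; apply/orP; left.
  apply/eqP; move: (N.-1)`!%:R (N%:R : R) N0 => f nn nn0; field.
  by rewrite gt_eqF.
(* Dividing by the positive prefactor leaves ln E - ln W <= 2 alpha N L, to be combined with the
   lower bound on ln E. *)
rewrite ler_pM2l; last by rewrite divr_gt0// mulr_gt0.
by move: (ln W) (ln E) lnE => w e; lra.
Qed.

Theorem propositionA1 (R : realType) (N : nat) (N_ge3 : (3 <= N)%N)
    (N_odd : odd N) (alpha : R) (alpha_gt0 : 0 < alpha)
    (I_ge0 : forall u : R -> R, L_r N u -> 0 <= I_functional alpha N u) :
  1 / 2 <= alpha.
Proof.
have [m Nm] : exists m, N = m.*2.+3.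
  by exists (N - 3)./2; rewrite -(odd_double_half N) N_odd; lia.
subst N; clear N_ge3 N_odd; rewrite leNgt; apply/negP => a12.
set N := m.*2.+3 in I_ge0; have N0 : 0 < N%:R :> R by rewrite ltr0n.
pose W : R := wint N (fun=> 1); pose c : R := 2 * (N%:R + 4) / N%:R.
(* [B] collects the terms independent of n: nonnegativity will force (1 - 2 alpha) ln n <= B, and n
   is chosen below to violate this. *)
pose B := ln W / N%:R + ln 2 / 2 + c + (1 - alpha) * ln m.+2%:R.
have a0 : 0 < 1 - 2 * alpha by lra.
pose n := (Num.trunc (expR (B / (1 - 2 * alpha)))).+1.
have n0 : 0 < n%:R :> R by rewrite ltr0n.
have lnn : B / (1 - 2 * alpha) < ln n%:R.
  by rewrite -ltr_expR lnK ?posrE// truncnS_gt.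
rewrite ltr_pdivrMr// in lnn.
have Lr : L_r N (horner (two_pole_poly m n : {poly R})).
  by apply: L_r_zonal_sum => k ->.
have n1 : (0 < n)%N by [].
clearbody n; have := ln_bound_of_I_ge0 n1 (I_ge0 _ Lr); rewrite -/N -/W -/c.
rewrite lnV ?posrE ?mulr_gt0 ?exprn_gt0// lnM ?posrE ?exprn_gt0// lnXn//.
move: (@even_green_sum_ge R m n n1) lnn; rewrite /B; clear B.
move: (even_green_sum m n : R) (ln n%:R) (ln m.+2%:R) (ln W) (ln 2) c.
move=> L x y w t c0.
move=> h2 h1 h3.
(* The factor 2 - 2 alpha is what multiplies L once the quadratic term is moved to the left; it is
   positive, so the lower bound on L may be inserted. *)
have h4 : (2 - 2 * alpha) * (x - y / 2) <= (2 - 2 * alpha) * L.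
  by rewrite ler_wpM2l//; lra.
have : N%:R^-1 * (N%:R / 2 * - (t + x *+ 2) + N%:R * (2 * L - c0) - w) <=
    N%:R^-1 * (2 * alpha * N%:R * L).
  by rewrite ler_wpM2l// invr_ge0 ltW.
have -> : N%:R^-1 * (2 * alpha * N%:R * L) = 2 * alpha * L.
  by field; rewrite gt_eqF.
have -> : N%:R^-1 * (N%:R / 2 * - (t + x *+ 2) + N%:R * (2 * L - c0) - w) =
   - (t / 2 + x) + (2 * L - c0) - w * N%:R^-1.
  by field; rewrite gt_eqF.
move: (N%:R^-1 : R) h1 => iN h1 h5.
lra.
Qed.
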